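(* Let $U$ be an optimal prefix-free machine and let $f:2^\omega\to[0,1]$, $f(x)=\sum_{\sigma\le_L x}2^{-K_U(\sigma)}$. There is an $x\in 2^\omega$ such that $f(x)$ is not 1-random.
   Context: A machine is a partial computable function $M$ from $2^{<\omega}$ to $2^{<\omega}$; it is prefix-free if its domain is a prefix-free set. $K_M(\sigma)=\min\{|\tau|: M(\tau)=\sigma\}$ ($=\infty$ if there is no such $\tau$, with $2^{-\infty}=0$). A prefix-free machine $U$ is optimal if for each prefix-free machine $M$ there is a constant $c$ with $K_U(\sigma)\le K_M(\sigma)+c$ for all $\sigma$. For $\sigma\in 2^{<\omega}$ and $x\in 2^\omega$, $\sigma<_L x$ means that there is $n$ with $\sigma\upharpoonright n=x\upharpoonright n$, $\sigma(n)=0$ and $x(n)=1$; $\sigma\le_L x$ means that $\sigma<_L x$ or $\sigma$ is an initial segment of $x$. A real $y$ is 1-random if there is a constant $c$ with $K_U(y\upharpoonright n)\ge n-c$ for all $n$. Reals in $[0,1]$ are identified with their binary expansions. *)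

(* Defs.v *)
From HB Require Import structures.
From mathcomp Require Import all_boot all_order all_algebra.
From mathcomp Require Import all_classical all_reals all_analysis.
Set Implicit Arguments.
Unset Strict Implicit.
Unset Printing Implicit Defensive.
Import Order.TTheory GRing.Theory Num.Theory.
Import numFieldNormedType.Exports.
Local Open Scope classical_set_scope.
Local Open Scope ring_scope.

(* Kleene's partial recursive functions, by arity; [recf_eval f v y] means     *)
(* that f(v) is defined with value y.                                          *)
Inductive recf : nat -> Type :=
| RZero k : recf k
| RSucc : recf 1
| RProj k : 'I_k -> recf k
| RComp k m : recf m -> ('I_m -> recf k) -> recf k
| RPrec k : recf k -> recf k.+2 -> recf k.+1
| RMu k : recf k.+1 -> recf k.

(* In [RPrec], h is the course of values h 0, ..., h (thead v): recursion is   *)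
(* on the first argument, and the step function receives n, h n and the        *)
(* parameters, in this order. In [RMu], f(z, v) must be defined and nonzero    *)
(* for every z smaller than the value y.                                       *)
Fixpoint recf_eval k (f : recf k) : k.-tuple nat -> nat -> Prop :=
  match f in recf k return k.-tuple nat -> nat -> Prop with
  | RZero _ => fun _ y => y = 0%N
  | RSucc => fun v y => y = (thead v).+1
  | RProj _ i => fun v y => y = tnth v i
  | RComp _ m f g => fun v y =>
      exists2 w : m.-tuple nat, forall i, recf_eval (g i) v (tnth w i) &
        recf_eval f w y
  | RPrec _ f g => fun v y =>
      exists h : nat -> nat,
        [/\ recf_eval f (behead_tuple v) (h 0%N),
            forall n, (n < thead v)%N ->
              recf_eval g [tuple of n :: h n :: behead_tuple v] (h n.+1)
          & y = h (thead v)]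
  | RMu _ f => fun v y =>
      recf_eval f [tuple of y :: v] 0%N /\
      forall z, (z < y)%N -> exists u, recf_eval f [tuple of z :: v] u.+1
  end.

(* Bijective base-2 numeration, a bijection between finite strings and nat.    *)
Fixpoint strcode (s : seq bool) : nat :=
  if s is b :: s' then ((strcode s').*2 + b).+1 else 0%N.

(* A partial function from strings to strings: [None] stands for undefined.    *)
Definition strpfun := seq bool -> option (seq bool).

Definition partial_computable (M : strpfun) : Prop :=
  exists c : recf 1, forall s t,
    M s = Some t <-> recf_eval c [tuple strcode s] (strcode t).

Definition prefix_free (A : set (seq bool)) : Prop :=
  forall s t, A s -> A t -> prefix s t -> s = t.

Definition prefix_free_machine (M : strpfun) : Prop :=
  partial_computable M /\ prefix_free [set s | M s != None].

(* Complexities live in nat extended with infinity, which is [None].           *)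
Definition complexity (M : strpfun) (s : seq bool) : option nat :=
  let P := fun n => `[< exists2 t, M t = Some s & size t = n >] in
  match pselect (exists n, P n) with
  | left exP => Some (ex_minn exP)
  | right _ => None
  end.

Definition oo_add (k : option nat) (c : nat) : option nat :=
  if k is Some m then Some (m + c)%N else None.

Definition oo_le (k l : option nat) : bool :=
  match k, l with
  | _, None => true
  | None, Some _ => false
  | Some m, Some n => (m <= n)%N
  end.

Definition optimal (U : strpfun) : Prop :=
  prefix_free_machine U /\
  forall M, prefix_free_machine M ->
    exists c, forall s, oo_le (complexity U s) (oo_add (complexity M s) c).

Definition restr (x : nat -> bool) (n : nat) : seq bool := mkseq x n.

Definition ltL (s : seq bool) (x : nat -> bool) : Prop :=
  exists n, [/\ (n < size s)%N, take n s = restr x n,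
                nth false s n = false & x n = true].

Definition leL (s : seq bool) (x : nat -> bool) : Prop :=
  ltL s x \/ s = restr x (size s).

Definition exp2N {R : realType} (k : option nat) : R :=
  if k is Some n then 2 ^- n else 0.

Lemma complexityP M s n : complexity M s = Some n ->
  exists2 t, M t = Some s & size t = n.
Proof.
rewrite /complexity; case: pselect => // exP [<-].
by case: ex_minnP => m /asboolP.
Qed.

Lemma kraft (R : realType) (L : seq (seq bool)) :
  uniq L -> {in L &, forall s t, prefix s t -> s = t} ->
  \sum_(t <- L) (2 ^- size t : R) <= 1.
Proof.
have [n] : exists n, all (fun t => (size t <= n)%N) L.
  exists (\max_(t <- L) size t)%N; apply/allP => t tL.
  exact: leq_bigmax_seq.
elim: n L => [|n IHn] L Ln uL pL.
  case: L uL Ln {pL} => [_ _|t [|t' L]]; first by rewrite big_nil.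
  - move=> _; rewrite /= andbT leqn0 => /eqP t0.
    by rewrite big_seq1 t0 expr0 invr1.
  - rewrite /= !leqn0 !inE negb_or => /andP[/andP[+ _] _].
    by case: t => [|//]; case: t' => [|b t'] //= _.
have [L0|L0] := boolP ([::] \in L).
  have Lnil : {subset L <= [:: [::]]}.
    by move=> t tL; rewrite inE -(pL _ _ L0 tL) ?prefix0s.
  have : (size L <= 1)%N by apply: (uniq_leq_size uL Lnil).
  case: L L0 {uL pL Lnil Ln} => // t [|//]; rewrite inE => /eqP <- _.
  by rewrite big_seq1 expr0 invr1.
pose D b := [seq behead t | t <- L & head false t == b].
have DE b t : (t \in D b) = (b :: t \in L).
  apply/mapP/idP => [[[|c u]]|bt].
  - by rewrite mem_filter (negPf L0) andbF.
  - by rewrite mem_filter /= => /andP[/eqP-> ?] ->.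
  - by exists (b :: t); rewrite // mem_filter eqxx.
have D1 b : \sum_(t <- D b) (2 ^- size t : R) <= 1.
  apply: IHn.
  - by apply/allP => t; rewrite DE => /(allP Ln).
  - rewrite map_inj_in_uniq ?filter_uniq// => -[|c u] [|d v];
    rewrite !mem_filter ?(negPf L0) ?andbF//=.
    by move=> /andP[/eqP-> _] /andP[/eqP-> _] ->.
  - move=> s t; rewrite !DE => sL tL st.
    by have [] : b :: s = b :: t by apply: pL; rewrite //= eqxx.
have DS b : \sum_(t <- L | head false t == b) (2 ^- size t : R)
            = 2^-1 * \sum_(t <- D b) 2 ^- size t.
  rewrite big_map big_filter mulr_sumr big_seq_cond [RHS]big_seq_cond.
  apply: eq_bigr => -[|c u] /=; rewrite ?(negPf L0)// => _.
  by rewrite exprS invfM.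
have -> : \sum_(t <- L) (2 ^- size t : R) =
    \sum_(t <- L | head false t == true) 2 ^- size t +
    \sum_(t <- L | head false t == false) 2 ^- size t.
  rewrite (bigID (fun t => head false t == true)); congr (_ + _).
  by apply: eq_bigl => t /=; case: head.
rewrite !DS -mulrDr ler_pdivrMl ?mulr1// (_ : 2 = 1 + 1)// lerD//.
Qed.

Lemma Omega_sum_le1 (R : realType) (U : strpfun) (A : set (seq bool)) :
  prefix_free [set s | U s != None] ->
  (\esum_(s in A) (exp2N (complexity U s) : R)%:E <= 1)%E.
Proof.
move=> pU; apply: ge_ereal_sup => _ [X [finX _] <-].
rewrite fsbig_finite//= sumEFin lee_fin.
set L := finmap.enum_fset _.
have uL : uniq L by exact: finmap.fset_uniq.
have /boolp.choice[p pE] : forall s, exists t, forall n,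
    complexity U s = Some n -> U t = Some s /\ size t = n.
  move=> s; case E: (complexity U s) => [n|]; last by exists [::].
  by have [t Ut tn] := complexityP E; exists t => _ [<-].
pose K s := complexity U s != None.
have Kp s : K s -> U (p s) = Some s.
  by rewrite /K; case E: complexity => [n|//] _; case: (pE _ _ E).
rewrite (bigID K)/= [X in _ + X]big1 ?addr0; last first.
  by move=> s; rewrite negbK => /eqP ->.
rewrite -big_filter.
have -> : \sum_(s <- [seq s <- L | K s]) (exp2N (complexity U s) : R)
        = \sum_(t <- [seq p s | s <- L & K s]) 2 ^- size t.
  rewrite big_map !big_filter; apply: eq_bigr => s; rewrite /K.
  by case E: complexity => [n|//] _; case: (pE _ _ E) => _ ->.
apply: kraft.
  rewrite map_inj_in_uniq ?filter_uniq// => s t; rewrite !mem_filter.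
  move=> /andP[Ks _] /andP[Kt _] st; have := Kp _ Ks.
  by rewrite st (Kp _ Kt) => -[].
move=> _ _ /mapP[s + ->] /mapP[t + ->]; rewrite !mem_filter.
by move=> /andP[Ks _] /andP[Kt _]; apply: pU; rewrite /= Kp.
Qed.

(* [fine] returns the sum itself when U is prefix-free, by [Omega_sum_le1].    *)
Definition Omega_fun {R : realType} (U : strpfun) (x : nat -> bool) : R :=
  fine (\esum_(s in [set s | leL s x]) (exp2N (complexity U s) : R)%:E).

Definition binary_expansion {R : realType} (b : nat -> bool) (y : R) : Prop :=
  series (fun i => (b i)%:R * 2 ^- i.+1 : R) @ \oo --> y.

Definition random_seq (U : strpfun) (b : nat -> bool) : Prop :=
  exists c, forall n, oo_le (Some n) (oo_add (complexity U (restr b n)) c).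

(* The choice of the expansion is immaterial: only dyadic rationals have two,  *)
(* and neither of these is random when U is optimal.                           *)
Definition one_random {R : realType} (U : strpfun) (y : R) : Prop :=
  exists2 b, binary_expansion b y & random_seq U b.

(* Main.v *)
Require Import Defs.
From HB Require Import structures.
From mathcomp Require Import all_boot all_order all_algebra.
From mathcomp Require Import all_classical all_reals all_analysis.
From mathcomp Require Import zify ring lra.
Set Implicit Arguments.
Unset Strict Implicit.
Unset Printing Implicit Defensive.
Import Order.TTheory GRing.Theory Num.Theory.
Import numFieldNormedType.Exports.

(** Write K for the complexity of U and f for the function of the theorem.
    The range C of f is a Cantor set whose gaps can be listed: for each string
    u the values of f jump from f(u0111...) to f(u1000...), because the strings
    u1, u10, u100, ... are counted in the second value and not in the first;
    an element of [f(000...), f(111...)] in none of these gaps is a value of f.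

    C is thick: the part of C on either side of a gap, up to the next gap that
    is at least as long, is at least t^-1 times as long as the gap, for a
    constant t. Indeed the length of the gap at u is the sum over k of
    2^-K(u10^k). Appending a 1 to a string, and changing its last 1 to 0 and
    then appending a 1, are computable maps, so they raise K by at most a
    constant. They send the strings u10^k to the strings u10^k1, which are all
    counted between f(u1000...) and f(u111...), and to the strings u00^k1, which
    are all counted between f(u000...) and f(u0111...).

    On the other hand, there are null sets of very large thickness which contain
    no random real. Fix a length n and remove from the line, for all j and k,
    the open interval of radius 2 * 2^-n * 2^-nj around (k + 1/2) * 2^-nj. A
    real outside these intervals has no binary expansion with a block
    1 0^(n-1) at a position that is a multiple of n. Prefixes of a sequence
    that avoids a word in all aligned blocks are compressible by a constant
    factor ([avoiding_not_random]). The thickness of the set of the remaining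
    reals grows like 2^n, so it exceeds t for n large.

    Newhouse's gap lemma ([gap_lemma]) says that two Cantor sets meet when the
    product of their thicknesses is at least 1 and neither lies in a gap of
    the other. It yields a value of f in the null set, hence a value of f that
    is not random. *)

(** * Total recursive functions *)

Section total_recursive.
Local Open Scope nat_scope.

Definition computes k (c : recf k) (F : k.-tuple nat -> nat) : Prop :=
  forall v y, recf_eval c v y <-> y = F v.

Definition recursive k (F : k.-tuple nat -> nat) : Prop :=
  exists c, computes c F.

Lemma eq_recursive k (F G : k.-tuple nat -> nat) :
  F =1 G -> recursive G -> recursive F.
Proof. by move=> FG [c cG]; exists c => v y; rewrite FG. Qed.

Lemma recursive_proj k (i : 'I_k) : recursive (fun v => tnth v i).
Proof. by exists (RProj i). Qed.

Lemma recursive_comp k m (F : m.-tuple nat -> nat)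
    (G : 'I_m -> k.-tuple nat -> nat) :
  recursive F -> (forall i, recursive (G i)) ->
  recursive (fun v => F [tuple G i v | i < m]).
Proof.
move=> [c cF] /boolp.choice[d dG]; exists (RComp c d) => v y /=; split.
  move=> [w wE /cF ->]; congr F; apply: eq_from_tnth => i.
  by rewrite tnth_mktuple; apply/dG/wE.
move=> ->; exists [tuple G i v | i < m]; last exact/cF.
by move=> i; rewrite tnth_mktuple; apply/dG.
Qed.

Lemma recursive_succ k (F : k.-tuple nat -> nat) :
  recursive F -> recursive (fun v => (F v).+1).
Proof.
move=> rF; have rS : recursive (fun w : 1.-tuple nat => (thead w).+1).
  by exists RSucc.
apply: eq_recursive (recursive_comp rS (fun=> rF)) => v.
by rewrite /thead tnth_mktuple.
Qed.

Lemma recursive_cst k n : recursive (fun _ : k.-tuple nat => n).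
Proof.
elim: n => [|n]; last exact: recursive_succ.
by exists (RZero k).
Qed.

(** The function H is given together with its recursion equations, so that
    the caller may use any convenient closed form for it. *)
Lemma recursive_prec k (F : k.-tuple nat -> nat) (G : k.+2.-tuple nat -> nat)
    (N : k.-tuple nat -> nat) (H : nat -> k.-tuple nat -> nat) :
  recursive F -> recursive G -> recursive N ->
  (forall v, H 0 v = F v) ->
  (forall n v, H n.+1 v = G [tuple of n :: H n v :: v]) ->
  recursive (fun v => H (N v) v).
Proof.
move=> [c cF] [d dG] rN H0 HS.
have rH : recursive (fun w : k.+1.-tuple nat => H (thead w) (behead_tuple w)).
  exists (RPrec c d) => w y /=; split=> [[h [/cF h0 hS ->]]|->].
    suff hE n : n <= thead w -> h n = H n (behead_tuple w) by exact: hE.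
    elim: n => [_|n IH nw]; first by rewrite h0 H0.
    by rewrite HS -(IH (ltnW nw)); apply/dG/hS.
  exists (fun n => H n (behead_tuple w)); split=> //; first by apply/cF.
  by move=> n _; apply/dG; rewrite HS.
pose P (i : 'I_k.+1) := if unlift ord0 i is Some j then
  fun v : k.-tuple nat => tnth v j else N.
have rP i : recursive (P i).
  by rewrite /P; case: unliftP => [j _|_]//; apply: recursive_proj.
apply: eq_recursive (recursive_comp rH rP) => v.
rewrite /thead tnth_mktuple /P unlift_none; congr H.
apply: eq_from_tnth => i; rewrite tnth_behead tnth_mktuple.
have -> : inord i.+1 = lift ord0 i.
  by apply: val_inj; rewrite /= inordK// ltnS.
by rewrite liftK.
Qed.

Lemma recursive_thead k : recursive (fun w : k.+1.-tuple nat => thead w).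
Proof. exact: recursive_proj. Qed.

Lemma tnth_lift0 k (w : k.+1.-tuple nat) (i : 'I_k) :
  tnth w (lift ord0 i) = tnth (behead_tuple w) i.
Proof.
rewrite tnth_behead; congr tnth; apply: val_inj.
by rewrite /= inordK// ltnS.
Qed.

Lemma recursive_behead k (F : k.-tuple nat -> nat) :
  recursive F -> recursive (fun w : k.+1.-tuple nat => F (behead_tuple w)).
Proof.
move=> rF.
apply: eq_recursive (recursive_comp rF (fun i => recursive_proj (lift ord0 i))).
move=> w; congr F; apply: eq_from_tnth => i.
by rewrite tnth_mktuple tnth_lift0.
Qed.

Lemma recursive_comp1 k (f : nat -> nat) (F : k.-tuple nat -> nat) :
  recursive (fun w : 1.-tuple nat => f (thead w)) -> recursive F ->
  recursive (fun v => f (F v)).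
Proof.
move=> rf rF; apply: eq_recursive (recursive_comp rf (fun=> rF)) => v.
by rewrite /thead tnth_mktuple.
Qed.

Lemma recursive_iter k (f : nat -> nat) (A N : k.-tuple nat -> nat) :
  recursive (fun w : 1.-tuple nat => f (thead w)) -> recursive A ->
  recursive N -> recursive (fun v => iter (N v) f (A v)).
Proof.
move=> rf rA rN.
have rG := recursive_comp1 rf (recursive_proj (lift ord0 ord0 : 'I_k.+2)).
exact: (recursive_prec (H := fun n v => iter n f (A v)) rA rG rN).
Qed.

Lemma recursive_add k (F G : k.-tuple nat -> nat) :
  recursive F -> recursive G -> recursive (fun v => F v + G v).
Proof.
move=> rF rG.
have rS : recursive (fun w : 1.-tuple nat => (thead w).+1) by exists RSucc.
apply: eq_recursive (recursive_iter rS rG rF) => v.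
by elim: (F v) => //= n <-.
Qed.

Lemma recursive_pred k (F : k.-tuple nat -> nat) :
  recursive F -> recursive (fun v => (F v).-1).
Proof.
move=> rF; pose i0 : 'I_k.+2 := ord0.
exact: (recursive_prec (H := fun n _ => n.-1) (recursive_cst k 0)
  (recursive_proj i0) rF).
Qed.

Lemma recursive_sub k (F G : k.-tuple nat -> nat) :
  recursive F -> recursive G -> recursive (fun v => F v - G v).
Proof.
move=> rF rG.
have rP : recursive (fun w : 1.-tuple nat => (thead w).-1).
  exact/recursive_pred/recursive_thead.
apply: eq_recursive (recursive_iter rP rF rG) => v.
by elim: (G v) => [|n IH]; rewrite ?subn0//= subnS IH.
Qed.

Lemma recursive_sum k (N : k.-tuple nat -> nat) (F : nat -> k.-tuple nat -> nat) :
  recursive N ->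
  recursive (fun w : k.+1.-tuple nat => F (thead w) (behead_tuple w)) ->
  recursive (fun v => \sum_(i < N v) F i v).
Proof.
move=> rN rF; pose i0 : 'I_k.+2 := ord0; pose i1 : 'I_k.+2 := lift ord0 ord0.
pose P (i : 'I_k.+1) : k.+2.-tuple nat -> nat :=
  if unlift ord0 i is Some j then
    fun v => tnth v (lift ord0 (lift ord0 j)) else fun v => tnth v i0.
have rP i : recursive (P i).
  by rewrite /P; case: unliftP => [j _|_]; apply: recursive_proj.
have rG := recursive_add (recursive_proj i1) (recursive_comp rF rP).
apply: (recursive_prec (H := fun n v => \sum_(i < n) F i v)
  (recursive_cst k 0) rG rN) => [v|n v]; first by rewrite big_ord0.
rewrite big_ord_recr /=; congr addn.
rewrite /thead tnth_mktuple /P unlift_none; congr F.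
apply: eq_from_tnth => i; rewrite -[RHS]tnth_lift0 tnth_mktuple liftK.
by rewrite !tnth_lift0; congr tnth; apply: val_inj.
Qed.

Lemma recursive_mul k (F G : k.-tuple nat -> nat) :
  recursive F -> recursive G -> recursive (fun v => F v * G v).
Proof.
move=> rF rG.
apply: eq_recursive (recursive_sum (F := fun=> F) rG (recursive_behead rF)) => v.
by rewrite sum_nat_const card_ord mulnC.
Qed.

Lemma recursive_exp k n (F : k.-tuple nat -> nat) :
  recursive F -> recursive (fun v => n ^ F v).
Proof.
move=> rF.
have rM : recursive (fun w : 1.-tuple nat => n * thead w).
  exact: recursive_mul (recursive_cst _ _) (recursive_thead _).
apply: eq_recursive (recursive_iter rM (recursive_cst k 1) rF) => v.
by elim: (F v) => [|m /= <-]; rewrite ?expn0// expnS.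
Qed.

Lemma recursive_leq k (F G : k.-tuple nat -> nat) :
  recursive F -> recursive G -> recursive (fun v => (F v <= G v) : nat).
Proof.
move=> rF rG.
apply: eq_recursive (recursive_sub (recursive_cst k 1) (recursive_sub rF rG)).
by move=> v; rewrite /leq; case: (_ - _).
Qed.

Lemma recursive_eq k (F G : k.-tuple nat -> nat) :
  recursive F -> recursive G -> recursive (fun v => (F v == G v) : nat).
Proof.
move=> rF rG; apply: eq_recursive
  (recursive_mul (recursive_leq rF rG) (recursive_leq rG rF)).
by move=> v; rewrite eqn_leq; case: (_ <= _); case: (_ <= _).
Qed.

Lemma recursive_finsum k n (F : nat -> k.-tuple nat -> nat) :
  (forall i, recursive (F i)) -> recursive (fun v => \sum_(i < n) F i v).
Proof.
move=> rF; elim: n => [|n IH].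
  by apply: eq_recursive (recursive_cst k 0) => v; rewrite big_ord0.
apply: eq_recursive (recursive_add IH (rF n)) => v.
by rewrite big_ord_recr.
Qed.

End total_recursive.

(** * Codes of strings, and two ways to build prefix-free machines *)

Section machines.
Local Open Scope nat_scope.

Lemma strcode_inj : injective strcode.
Proof.
elim=> [|b s IH] [|c t] //= [bsct].
have bc : b = c.
  by move/(congr1 odd): bsct; rewrite !oddD !odd_double /=; case: b c => [] [].
by move: bsct; rewrite bc => /addIn/double_inj/IH ->.
Qed.

Lemma strcode_surj n : exists s, strcode s = n.
Proof.
elim/ltn_ind: n => -[_|n IH]; first by exists [::].
have [|s sE] := IH n./2; first lia.
by exists (odd n :: s); rewrite /= sE addnC odd_double_half.
Qed.

Lemma strcode_cat u s : strcode (u ++ s) = 2 ^ size u * strcode s + strcode u.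
Proof.
elim: u => [|b u IH] /=; first by rewrite mul1n addn0.
by rewrite IH expnS -!muln2; lia.
Qed.

Lemma strcode_ge s : 2 ^ size s <= (strcode s).+1.
Proof. by elim: s => //= b s IH; rewrite expnS -muln2; lia. Qed.

Lemma strcode_lt s : (strcode s).+1 < 2 ^ (size s).+1.
Proof. by elim: s => //= b s IH; rewrite expnS -muln2; case: b; lia. Qed.

Definition strpfun_of (G : seq bool -> seq bool -> Prop) : strpfun := fun s =>
  match pselect (exists t, G s t) with
  | left e => Some (projT1 (cid e))
  | right _ => None
  end.

Lemma strpfun_ofP (G : seq bool -> seq bool -> Prop) s t :
  (forall t t', G s t -> G s t' -> t = t') ->
  strpfun_of G s = Some t <-> G s t.
Proof.
move=> Gfun; rewrite /strpfun_of; case: pselect => [e|noG].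
  case: cid => t' /= Gt'; split=> [[<-]//|Gt].
  by rewrite (Gfun _ _ Gt Gt').
by split=> // Gt; case: noG; exists t.
Qed.

Lemma complexity_le M s t :
  M t = Some s -> oo_le (complexity M s) (Some (size t)).
Proof.
move=> Mt; rewrite /complexity; case: pselect => [e|[]]; last first.
  by exists (size t); apply/asboolP; exists t.
by case: ex_minnP => m _; apply; apply/asboolP; exists t.
Qed.

Lemma oo_le_trans : transitive oo_le.
Proof. by move=> [l|] [k|] [m|] //=; apply: leq_trans. Qed.

Lemma oo_add_le k l c : oo_le k l -> oo_le (oo_add k c) (oo_add l c).
Proof. by case: k l => [k|] [l|] //=; rewrite leq_add2r. Qed.

(** A machine may search for a seed z whose encoding E z is its input, and
    then print F z: no parsing of the input is needed, and the domain is the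
    range of E. *)
Lemma complexity_search U (E F : nat -> nat) : optimal U ->
  recursive (fun v : 1.-tuple nat => E (thead v)) ->
  recursive (fun v : 1.-tuple nat => F (thead v)) ->
  (forall z z', E z = E z' -> F z = F z') ->
  (forall z z' s s', strcode s = E z -> strcode s' = E z' ->
    prefix s s' -> s = s') ->
  exists c, forall z s t, strcode s = E z -> strcode t = F z ->
    oo_le (complexity U t) (Some (size s + c)).
Proof.
move=> [_ Uopt] rE rF EF Epf.
pose G s t := exists2 z, strcode s = E z & strcode t = F z.
have Gfun s t t' : G s t -> G s t' -> t = t'.
  move=> [z sz tz] [z' sz' tz']; apply: strcode_inj.
  by rewrite tz tz'; apply: EF; rewrite -sz.
pose M := strpfun_of G.
have ME s t : M s = Some t <-> G s t by apply: strpfun_ofP; apply: Gfun.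
have Mpf : prefix_free [set s | M s != None].
  move=> s s' /=; case Ms: (M s) => [t|//] _; case Ms': (M s') => [t'|//] _.
  by case/ME: Ms => z sz _; case/ME: Ms' => z' sz' _; apply: Epf sz sz'.
have Mcomp : partial_computable M.
  have rz := recursive_thead 1; have rs := recursive_behead (recursive_thead 0).
  have rEz := recursive_comp1 rE rz.
  have [d dE] := recursive_add (recursive_sub rEz rs) (recursive_sub rs rEz).
  have [cF cFE] := rF.
  exists (RComp cF (fun _ : 'I_1 => RMu d)) => s t; rewrite ME /=.
  have d0 z y : recf_eval d [tuple of z :: [tuple strcode s]] y <->
      y = (E z - strcode s) + (strcode s - E z).
    by rewrite dE; split=> ->.
  split=> [[z0 sz0 tz0]|[w /(_ ord0)[+ _] /cFE tw]]; last first.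
    by move=> /d0 wE; exists (thead w) => //; rewrite /thead; lia.
  have exz : exists z, E z == strcode s by exists z0; rewrite sz0.
  case: (ex_minnP exz) => z /eqP zs zmin.
  exists [tuple z]; last by apply/cFE; rewrite tz0; apply: EF; rewrite -sz0.
  move=> i; rewrite (tnth_nth 0) ord1 /=; split; first by apply/d0; lia.
  move=> z1 z1z; exists ((E z1 - strcode s) + (strcode s - E z1)).-1.
  apply/d0; rewrite prednK//.
  have /eqP : E z1 != strcode s by apply: contraL z1z => /zmin; rewrite -leqNgt.
  lia.
have [c cE] := Uopt M (conj Mcomp Mpf); exists c => z s t sz tz.
apply: oo_le_trans (cE t) _.
apply: (oo_add_le c (@complexity_le M t s _)).
by apply/ME; exists z.
Qed.

(** Applying a computable map to the output of U gives a machine with the same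
    domain, which is therefore still prefix-free. *)
Lemma complexity_image U (G : nat -> nat) : optimal U ->
  recursive (fun v : 1.-tuple nat => G (thead v)) ->
  exists c, forall s t, strcode t = G (strcode s) ->
    oo_le (complexity U t) (oo_add (complexity U s) c).
Proof.
move=> [[[cU cUE] Upf] Uopt] [cG cGE].
pose R p t := exists2 s, U p = Some s & strcode t = G (strcode s).
pose M := strpfun_of R.
have ME p t : M p = Some t <-> R p t.
  apply: strpfun_ofP => {}t t' [s Us tG] [s' Us' t'G]; apply: strcode_inj.
  by move: Us'; rewrite tG t'G Us => -[->].
have Mpf : prefix_free [set s | M s != None].
  move=> p p' /=; case Mp: (M p) => [t|//] _; case Mp': (M p') => [t'|//] _.
  case/ME: Mp => s Us _; case/ME: Mp' => s' Us' _.
  by apply: Upf; rewrite /= ?Us ?Us'.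
have Mcomp : partial_computable M.
  exists (RComp cG (fun _ : 'I_1 => cU)) => p t; rewrite ME /=; split.
    move=> [s /cUE Us tG]; exists [tuple strcode s]; last by apply/cGE.
    by move=> i; rewrite (tnth_nth 0) ord1.
  move=> [w /(_ ord0) + /cGE tw]; have [s sw] := strcode_surj (tnth w ord0).
  by rewrite -sw => /cUE Us; exists s; rewrite // tw sw.
have [c cE] := Uopt M (conj Mcomp Mpf); exists c => s t tG.
apply: oo_le_trans (cE t) (oo_add_le c _).
case Ks: (complexity U s) => [n|//]; last by case: complexity.
have [p Up <-] := complexityP Ks.
by apply: complexity_le; apply/ME; exists s.
Qed.

End machines.

Section string_maps.
Local Open Scope nat_scope.

Lemma sum_lt_ord n m : \sum_(i < n) (i < m : nat) = minn n m.
Proof.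
elim: n => [|n IH]; first by rewrite big_ord0 min0n.
by rewrite big_ord_recr /= IH; case: (ltnP n m) => nm /=; lia.
Qed.

(** The binary logarithm of a positive number, as a bounded sum in order to be
    visibly recursive. *)
Definition log2 v := \sum_(i < v) (2 ^ i.+1 <= v : nat).

Lemma log2E n v : 2 ^ n <= v -> v < 2 ^ n.+1 -> log2 v = n.
Proof.
move=> nv vn; have nv' : n <= v by apply: leq_trans nv; apply/ltnW/ltn_expl.
rewrite -[RHS](minn_idPr nv') -sum_lt_ord; apply: eq_bigr => i _.
congr nat_of_bool; apply/idP/idP => [iv|ni].
  by rewrite -ltnS -(ltn_exp2l _ _ (isT : 1 < 2)) (leq_ltn_trans iv).
by apply: leq_trans nv; rewrite leq_exp2l.
Qed.

Lemma recursive_log2 k (F : k.-tuple nat -> nat) :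
  recursive F -> recursive (fun v => log2 (F v)).
Proof.
move=> rF; have rE := recursive_exp 2 (recursive_succ (recursive_thead k)).
exact: (recursive_sum (F := fun i v => 2 ^ i.+1 <= F v : nat) rF
  (recursive_leq rE (recursive_behead rF))).
Qed.

Lemma log2_strcode s : log2 (strcode s).+1 = size s.
Proof. by apply: log2E (strcode_ge s) (strcode_lt s). Qed.

Lemma strcode_nseq0 k : (strcode (nseq k false)).+1 = 2 ^ k.
Proof. by elim: k => //= k IH; rewrite expnS -IH; lia. Qed.

Variables (U : strpfun) (U_optimal : optimal U).

Lemma complexity_rcons :
  exists c, forall s, oo_le (complexity U (rcons s true)) (oo_add (complexity U s) c).
Proof.
pose G n := n + 2 ^ (log2 n.+1).+1.
have rG : recursive (fun v : 1.-tuple nat => G (thead v)).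
  have rt := recursive_thead 0.
  have rL := recursive_log2 (recursive_succ rt).
  exact: recursive_add rt (recursive_exp 2 (recursive_succ rL)).
have [c cE] := complexity_image U_optimal rG; exists c => s; apply: cE.
by rewrite /G log2_strcode -cats1 strcode_cat expnS /=; lia.
Qed.

(** The binary digits of the code of a string plus one are the string, read from
    the low end, and then a 1. Hence turning the last 1 of the string into 0
    removes the second highest 1 of this number. *)
Lemma complexity_flip :
  exists c, forall s k,
    oo_le (complexity U (rcons (rcons s false ++ nseq k false) true))
          (oo_add (complexity U (rcons s true ++ nseq k false)) c).
Proof.
pose L n := log2 n.+1.
pose G n := n - 2 ^ log2 (n.+1 - 2 ^ L n) + 2 ^ (L n).+1.
have rG : recursive (fun v : 1.-tuple nat => G (thead v)).
  have rt := recursive_thead 0; have rSt := recursive_succ rt.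
  have rL := recursive_log2 rSt.
  have rB := recursive_log2 (recursive_sub rSt (recursive_exp 2 rL)).
  exact: (recursive_add (recursive_sub rt (recursive_exp 2 rB))
    (recursive_exp 2 (recursive_succ rL))).
have [c cE] := complexity_image U_optimal rG; exists c => s k; apply: cE.
rewrite /G /L log2_strcode -!cats1 -!catA !strcode_cat /= !size_cat /= size_nseq.
have k0 := strcode_nseq0 k; have s1 := strcode_ge s; have s2 := strcode_lt s.
have sk : 2 ^ (size s + k.+1) = 2 ^ size s * (2 * 2 ^ k).
  by rewrite expnD expnS.
rewrite sk.
rewrite [log2 _](_ : _ = size s); last first.
  by apply: log2E; move: s2; rewrite ?expnS; nia.
rewrite !expnS sk -k0; move: (strcode (nseq _ _)) (2 ^ size s) => z a; nia.
Qed.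

End string_maps.

(** * Sequences avoiding a word in aligned blocks are not random *)

Section block_codes.
Local Open Scope nat_scope.

(** Finite lists of digits 1..A are coded by their value in bijective base A;
    folding over such a list is recursive because its length is at most
    its value. *)
Lemma recursive_digit_fold A P (g : nat -> nat) : 0 < A ->
  exists H : nat -> nat, [/\ recursive (fun v : 1.-tuple nat => H (thead v)),
    H 0 = 0 & forall d z, d < A -> H (A * z + d.+1) = g d + P * H z].
Proof.
move=> A0; pose q z := \sum_(i < z) (i.+1 * A < z : nat).
pose ga z := \sum_(i < A) g i * (z == A * q z + i.+1).
pose S n z := \sum_(j < n) P ^ j * ga (iter j q z).
have rq : recursive (fun v : 1.-tuple nat => q (thead v)).
  have rM := recursive_mul (recursive_succ (recursive_thead 1)) (recursive_cst _ A).
  have rB := recursive_behead (recursive_thead 0).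
  exact: (recursive_sum (F := fun i v => i.+1 * A < thead v : nat)
    (recursive_thead 0) (recursive_leq (recursive_succ rM) rB)).
have rga : recursive (fun v : 1.-tuple nat => ga (thead v)).
  have rt := recursive_thead 0.
  apply: (@recursive_finsum _ A
    (fun i v => g i * (thead v == A * q (thead v) + i.+1))) => i.
  apply: (recursive_mul (recursive_cst _ _)); apply: (recursive_eq rt).
  exact: (recursive_add (recursive_mul (recursive_cst _ A) rq) (recursive_cst _ _)).
have rH : recursive (fun v : 1.-tuple nat => S (thead v) (thead v)).
  have rt := recursive_thead 1; have rB := recursive_behead (recursive_thead 0).
  have rI := recursive_comp1 rga (recursive_iter rq rB rt).
  exact: (recursive_sum (F := fun j v => P ^ j * ga (iter j q (thead v)))
    (recursive_thead 0) (recursive_mul (recursive_exp P rt) rI)).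
have qE d z : d < A -> q (A * z + d.+1) = z.
  move=> dA; rewrite /q -[RHS](minn_idPr (_ : z <= A * z + d.+1)); last nia.
  rewrite -sum_lt_ord; apply: eq_bigr => i _; congr nat_of_bool.
  by apply/idP/idP => ?; nia.
have gaE d z : d < A -> ga (A * z + d.+1) = g d.
  move=> dA; rewrite /ga qE// (bigD1 (Ordinal dA)) //= eqxx muln1 big1 ?addn0//.
  move=> i /eqP id; case: eqP; rewrite ?muln0// => e; case: id.
  by apply: val_inj => /=; lia.
have q_lt z : 0 < z -> q z < z.
  case: z => // z _; rewrite /q ltnS big_ord_recr /=.
  rewrite [_ < z.+1](_ : _ = false) ?addn0; last by apply/negbTE; nia.
  rewrite -[leqRHS]card_ord -sum1_card; apply: leq_sum => i _.
  exact: leq_b1.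
have ga0 : ga 0 = 0 by rewrite /ga big1// => i _; rewrite addnS muln0.
have q0 : q 0 = 0 by rewrite /q big_ord0.
have S0 n : S n 0 = 0.
  rewrite /S big1// => j _; rewrite (_ : iter j q 0 = 0) ?ga0 ?muln0//.
  by elim: (j : nat) => //= i ->.
have SS n z : S n.+1 z = ga z + P * S n (q z).
  rewrite /S big_ord_recl /= mul1n; congr addn; rewrite big_distrr /=.
  by apply: eq_bigr => i _; rewrite /bump /= add1n expnS -iterS iterSr mulnA.
have Sz n z : z <= n -> S n z = S z z.
  elim/ltn_ind: z n => -[_ n _|z IH [|n] zn]; rewrite ?S0// !SS.
  have qz := q_lt _ (ltn0Sn z).
  by rewrite (IH _ qz n) ?(IH _ qz z)//; lia.
exists (fun z => S z z); split=> // d z dA.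
rewrite -(Sz (A * z + d.+1).-1.+1); last lia.
by rewrite SS gaE// qE// Sz//; nia.
Qed.

(** Blocks of N bits taken from a set of 2^n blocks are written with n+1 bits
    each: n bits for the block, and a leading 1 which says that the program
    goes on, so that the set of programs is prefix-free. *)
Lemma complexity_blocks U n N (dec : nat -> seq bool) : optimal U ->
  (forall d, d < 2 ^ n -> size (dec d) = N) ->
  exists c, forall ds, all (fun d => d < 2 ^ n) ds ->
    oo_le (complexity U (flatten (map dec ds))) (Some (n.+1 * size ds + c)).
Proof.
move=> U_optimal dec_size; have A0 : 0 < 2 ^ n by rewrite expn_gt0.
have /boolp.choice[bits bitsE] d := strcode_surj (d + (2 ^ n).-1).
have bits_size d : d < 2 ^ n -> size (bits d) = n.
  move=> dn; rewrite -log2_strcode bitsE; apply: log2E; first lia.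
  by rewrite expnS; lia.
have bits_inj d d' : bits d = bits d' -> d = d'.
  by move/(congr1 strcode); rewrite !bitsE; lia.
pose enc := foldr (fun d s => true :: bits d ++ s) [:: false].
pose val := foldr (fun d z => 2 ^ n * z + d.+1) 0.
have val_surj z : exists2 ds, all (fun d => d < 2 ^ n) ds & val ds = z.
  elim/ltn_ind: z => -[_|z IH]; first by exists [::].
  have [|ds dsn dsz] := IH (z %/ 2 ^ n); first by rewrite ltnS leq_div.
  exists (z %% 2 ^ n :: ds); first by rewrite /= ltn_pmod.
  by rewrite /= dsz addnS mulnC -divn_eq.
have enc_prefix ds ds' r : all (fun d => d < 2 ^ n) ds ->
    all (fun d => d < 2 ^ n) ds' -> enc ds' = enc ds ++ r -> ds = ds'.
  elim: ds ds' => [|d ds IH] [|d' ds'] //= /andP[dn dsn] /andP[dn' dsn'] [].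
  move/eqP; rewrite -catA eqseq_cat ?bits_size// => /andP[/eqP/bits_inj ->].
  by move=> /eqP/(IH _ dsn dsn') ->.
pose P := 2 ^ n.+1.
have [HE [rHE HE0 HES]] :=
  recursive_digit_fold P (fun d => strcode (true :: bits d) + P.-1) A0.
have [HF [rHF HF0 HFS]] :=
  recursive_digit_fold (2 ^ N) (fun d => strcode (dec d)) A0.
have P0 : 0 < P by rewrite expn_gt0.
have HEE ds : all (fun d => d < 2 ^ n) ds -> (HE (val ds)).+1 = strcode (enc ds).
  elim: ds => [_|d ds IH /= /andP[dn /IH e]]; first by rewrite HE0.
  rewrite HES//= strcode_cat bits_size// -e /P expnS -!muln2.
  by rewrite /P expnS in P0; nia.
have HFE ds : all (fun d => d < 2 ^ n) ds ->
    HF (val ds) = strcode (flatten (map dec ds)).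
  elim: ds => [_|d ds IH /= /andP[dn /IH e]]; first by rewrite HF0.
  by rewrite HFS// strcode_cat dec_size// -e addnC.
have [||c cE] := @complexity_search U (fun z => (HE z).+1) HF
  U_optimal (recursive_succ rHE) rHF.
- move=> z z'; have [ds dsn <-] := val_surj z; have [ds' dsn' <-] := val_surj z'.
  rewrite !HEE// => /strcode_inj e; suff -> : ds = ds' by [].
  by apply: (enc_prefix _ _ [::] dsn dsn'); rewrite cats0.
- move=> z z' s s'.
  have [ds dsn <-] := val_surj z; have [ds' dsn' <-] := val_surj z'.
  rewrite !HEE// => /strcode_inj -> /strcode_inj -> /prefixP[r e].
  by rewrite (enc_prefix _ _ r dsn dsn' e).
exists c.+1 => ds dsn.
have := cE (val ds) (enc ds) _ (esym (HEE _ dsn)) (esym (HFE _ dsn)).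
suff -> : size (enc ds) = (n.+1 * size ds).+1 by rewrite addSnnS.
elim: ds dsn => [_|d ds IH /= /andP[dn /IH e]]; first by rewrite muln0.
by rewrite size_cat bits_size// e; lia.
Qed.

(** The machine that is defined on the empty program only and prints t is
    prefix-free. *)
Lemma complexity_finite U t : optimal U -> complexity U t != None.
Proof.
move=> U_optimal.
have [//||c cE] := @complexity_search U (fun=> 0) (fun=> strcode t) U_optimal
  (recursive_cst 1 0) (recursive_cst 1 (strcode t)).
  by move=> _ _ [|//] [|//].
by have := cE 0 [::] t erefl erefl; case: complexity.
Qed.

End block_codes.

Section avoiding.
Local Open Scope nat_scope.

Lemma mkseq_addn T (f : nat -> T) m n :
  mkseq f (m + n) = mkseq f m ++ mkseq (fun i => f (m + i)) n.
Proof.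
rewrite /mkseq iotaD map_cat add0n -{2}[m]addn0 iotaDl -map_comp.
by [].
Qed.

(** Bernoulli's inequality: the proportion of sequences of q blocks that avoid
    one of a+1 possible blocks is at most 1/4 for q = 3a+1. *)
Lemma expn_pred_le a : 4 * a ^ (3 * a).+1 <= a.+1 ^ (3 * a).+1.
Proof.
have [->//|a0] := posnP a.
have H n : a ^ n * (a + n) <= a * a.+1 ^ n.
  elim: n => [|n IH]; first by rewrite !expn0; lia.
  have := leq_mul IH (leqnn a.+1); rewrite !expnS; nia.
have {H} := H (3 * a); rewrite !expnS.
move: (a ^ (3 * a)) (a.+1 ^ (3 * a)) => x y xy.
have {xy} : 4 * x <= y by rewrite -(leq_pmul2l a0); lia.
nia.
Qed.

Fixpoint avoiding m (w : seq bool) q : seq (seq bool) :=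
  if q is q'.+1 then
    [seq u ++ v | u <- rem w [seq val t | t <- enum {: m.-tuple bool}],
                  v <- avoiding m w q']
  else [:: [::]].

Lemma size_avoiding m (w : m.-tuple bool) q :
  size (avoiding m w q) = (2 ^ m).-1 ^ q.
Proof.
elim: q => //= q IH; rewrite size_allpairs IH expnS size_rem; last first.
  by apply: map_f; rewrite mem_enum.
by rewrite size_map -cardE card_tuple card_bool.
Qed.

Lemma size_mem_avoiding m w q u : u \in avoiding m w q -> size u = q * m.
Proof.
elim: q u => [|q IH] u /=; first by rewrite inE => /eqP ->.
move=> /allpairsP[[s t] /= [/mem_rem/mapP[s' _ ->] /IH tq ->]].
by rewrite size_cat size_tuple tq.
Qed.

Lemma mem_avoiding m w q (b : nat -> bool) :
  (forall j, mkseq (fun i => b (j * m + i)) m <> w) ->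
  mkseq b (q * m) \in avoiding m w q.
Proof.
elim: q b => //= q IH b bw; rewrite mulSn mkseq_addn.
apply: allpairs_f; last first.
  apply: IH => j.
  rewrite (@eq_mkseq _ _ (fun i => b (j.+1 * m + i)))// => i.
  by rewrite mulSn addnA.
have um : uniq [seq val t | t <- enum {: m.-tuple bool}].
  by rewrite map_inj_uniq ?enum_uniq//; apply: val_inj.
rewrite mem_rem_uniq// inE; apply/andP; split; first exact/eqP/(bw 0).
apply/mapP; exists [tuple b i | i < m]; rewrite ?mem_enum//.
by rewrite /mkseq -val_enum_ord -map_comp.
Qed.

(** There are (2^m - 1)^q ways to fill q consecutive blocks. For q large
    this is at most 2^(mq-2), so that [complexity_blocks] writes mq bits of
    the sequence with mq - 1 bits. Repeating this saves arbitrarily many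
    bits. *)
Lemma avoiding_not_random U (b : nat -> bool) m (w : seq bool) :
  optimal U -> 0 < m -> size w = m ->
  (forall j, mkseq (fun i => b (j * m + i)) m <> w) -> ~ random_seq U b.
Proof.
move=> U_optimal m0 wm bw [c' bc'].
pose a := (2 ^ m).-1; pose q := (3 * a).+1; pose N := q * m.
have a1 : 0 < a by have := leq_pexp2l (isT : 0 < 2) m0; rewrite /a; lia.
have aS : a.+1 = 2 ^ m by rewrite /a prednK ?expn_gt0.
have aN : 4 * a ^ q <= 2 ^ N.
  by rewrite /N [q * m]mulnC expnM -aS; apply: expn_pred_le.
have N2 : 1 < N.
  rewrite -(leq_exp2l _ _ (isT : 1 < 2)); apply: leq_trans aN.
  by rewrite leq_pmulr ?expn_gt0 ?a1.
have [n nN] : exists n, N = n.+2 by exists N.-2; lia.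
have an : a ^ q <= 2 ^ n by move: aN; rewrite nN !expnS; lia.
pose D := avoiding m w q; pose dec := nth (nseq N false) D.
have Dsize : size D = a ^ q.
  by rewrite /D -[w]/(val (Tuple (introT eqP wm))) size_avoiding.
have dec_size d : d < 2 ^ n -> size (dec d) = N.
  move=> _; have [dD|Dd] := ltnP d (size D); last first.
    by rewrite /dec nth_default// size_nseq.
  exact/(@size_mem_avoiding m w)/mem_nth.
have [c cE] := complexity_blocks U_optimal dec_size.
pose blk k := mkseq (fun i => b (k * N + i)) N.
have blkD k : blk k \in D.
  apply: mem_avoiding => j.
  rewrite (@eq_mkseq _ _ (fun i => b ((k * q + j) * m + i)))// => i.
  by rewrite mulnDl -mulnA -addnA.
pose ds i := mkseq (fun k => index (blk k) D) i.
have dsE i : flatten (map dec (ds i)) = restr b (i * N).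
  rewrite -map_comp (eq_map (g := blk)); last first.
    by move=> k; rewrite /= /dec nth_index.
  elim: i => // i IH; rewrite -addn1 iotaD map_cat flatten_cat IH /= cats0.
  by rewrite mulnDl mul1n /restr mkseq_addn.
have dsn i : all (fun d => d < 2 ^ n) (ds i).
  apply/allP => _ /mapP[k _ ->]; apply: leq_trans an.
  by rewrite -Dsize index_mem.
pose i := (c + c').+1; have := cE _ (dsn i); have := bc' (i * N).
rewrite dsE size_mkseq; case: complexity => //= k; rewrite nN /i; nia.
Qed.

End avoiding.

(** * The gap lemma *)

Section gap_lemma.
Local Open Scope ring_scope.
Variable R : realType.

Lemma seq_argmin (T : eqType) (w : T -> R) (s : seq T) :
  s != [::] -> exists2 k, k \in s & {in s, forall k', w k <= w k'}.
Proof.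
elim: s => // x [_ _|y s IH _].
  by exists x => [|k']; rewrite inE// => /eqP ->.
have [//|k ks kmin] := IH.
have [xk|kx] := leP (w x) (w k).
  exists x => [|k']; rewrite inE ?eqxx// => /predU1P[->//|/kmin].
  exact: le_trans.
exists k => [|k']; first by rewrite inE ks orbT.
by rewrite inE => /predU1P[->|/kmin//]; apply: ltW.
Qed.

(** A cover with the least number of intervals: every member then contains a
    point of the segment that lies in no other member. *)
Lemma irredundant_cover (T : choiceType) (l r : T -> R) (c0 c1 : R) :
  (forall y, c0 <= y <= c1 -> exists k, l k < y < r k) ->
  exists s : seq T,
    (forall y, c0 <= y <= c1 -> exists2 k, k \in s & l k < y < r k) /\
    {in s, forall k, exists2 y, c0 <= y <= c1 &
      l k < y < r k /\ {in s, forall k', l k' < y < r k' -> k' = k}}.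
Proof.
move=> cov.
pose covers (s : seq T) :=
  forall y, c0 <= y <= c1 -> exists2 k, k \in s & l k < y < r k.
have [s0 s0cov] : exists s, covers s.
  have := @segment_compact R c0 c1; rewrite compact_cover.
  move=> /(_ T setT (fun k => `]l k, r k[%classic)) [||s _ sc].
  - by move=> k _; apply: interval_open.
  - by move=> y; rewrite /= in_itv /= => /cov[k yk]; exists k; rewrite //= in_itv.
  exists (finmap.enum_fset s) => y yc; have [|k ks] := sc y; first by rewrite /= in_itv.
  by rewrite /= in_itv => yk; exists k.
have exn : exists n, `[< exists2 s, size s = n & covers s >].
  by exists (size s0); apply/asboolP; exists s0.
case: (ex_minnP exn) => _ /asboolP[s <- scov] smin; exists s; split=> // k ks.
have : ~ covers [seq k' <- s | k' != k].
  move=> cov'; suff : (size [seq k' <- s | k' != k] < size s)%N.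
    rewrite ltnNge => /negP; apply; apply: smin; apply/asboolP.
    by exists [seq k' <- s | k' != k].
  rewrite size_filter -[ltnRHS](count_predC (pred1 k)) -[ltnLHS]add0n ltn_add2r.
  by rewrite -has_count has_pred1.
move=> /existsNP[y] /not_implyP[yc ny]; exists y => //.
have other k' : k' \in s -> l k' < y < r k' -> k' = k.
  move=> k's yk'; apply/eqP/negPn/negP => k'k; apply: ny; exists k' => //.
  by rewrite mem_filter k'k.
split=> [|//]; have [k' k's yk'] := scov y yc.
by rewrite -(other k').
Qed.

Definition apart (I : Type) (l r : I -> R) (t : R) (i i' : I) :=
  r i + t * Num.min (r i - l i) (r i' - l i') <= l i'.

Definition nested (I : Type) (l r : I -> R) (i i' : I) :=
  l i' <= l i /\ r i <= r i'.

(** Take a finite irredundant cover of the segment by intervals F and G, and in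
    it the member of least weight, where an F counts with its length and a G
    with its length divided by t. Its endpoints are covered by members of the
    other family, because two members of the same family are disjoint or
    nested, and irredundancy excludes the latter. If it is a G, then it contains
    the space between two F's; if it is an F, then it contains the space between
    two G's, or between a G and an end of the segment. These neighbours weigh no
    less, so by thickness the space is too long to fit. *)
Lemma gap_lemma (I J : choiceType) (lF rF : I -> R) (lG rG : J -> R)
    (c0 c1 t : R) :
  0 < t -> c0 <= c1 ->
  (forall i, rF i - lF i < c1 - c0) ->
  (forall i i', i <> i' -> [\/ nested lF rF i i', nested lF rF i' i,
     apart lF rF t i i' | apart lF rF t i' i]) ->
  (forall j, lG j < rG j) ->
  (forall j, c0 + t^-1 * (rG j - lG j) <= lG j) ->
  (forall j, rG j + t^-1 * (rG j - lG j) <= c1) ->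
  (forall j j', j <> j' ->
     apart lG rG t^-1 j j' \/ apart lG rG t^-1 j' j) ->
  exists y, [/\ c0 <= y <= c1, forall i, ~ (lF i < y < rF i) &
    forall j, ~ (lG j < y < rG j)].
Proof.
move=> t0 c01 ltF sepF G0 Gc0 Gc1 sepG; apply: contrapT => ncov.
have ti0 : 0 < t^-1 by rewrite invr_gt0.
pose l (k : I + J) := match k with inl i => lF i | inr j => lG j end.
pose r (k : I + J) := match k with inl i => rF i | inr j => rG j end.
have [|s [scov sirr]] := @irredundant_cover (I + J)%type l r c0 c1.
  move=> y yc; apply: contrapT => ny; apply: ncov; exists y; split=> // k yk.
    by apply: ny; exists (inl k).
  by apply: ny; exists (inr k).
pose w (k : I + J) := match k with
  inl i => rF i - lF i | inr j => t^-1 * (rG j - lG j) end.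
have [|k ks kmin] := @seq_argmin _ w s.
  by have [|k] := scov c0; [rewrite lexx | case: (s)].
have notin k1 k2 : k1 \in s -> k2 \in s -> k1 <> k2 ->
    ~ (l k2 <= l k1 /\ r k1 <= r k2).
  move=> k1s k2s k12 [l21 r12]; have [y yc [yk1 yk]] := sirr _ k1s.
  by apply: k12; rewrite (yk k2)//; lra.
have GG j j' : j <> j' -> rG j <= lG j' \/ rG j' <= lG j.
  move=> /sepG; rewrite /apart.
  have jj : 0 <= t^-1 * Num.min (rG j - lG j) (rG j' - lG j').
    by rewrite mulr_ge0 ?ltW// lt_min !subr_gt0 !G0.
  have jj' : 0 <= t^-1 * Num.min (rG j' - lG j') (rG j - lG j).
    by rewrite mulr_ge0 ?ltW// lt_min !subr_gt0 !G0.
  by case=> ?; [left|right]; lra.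
case: k ks kmin => [i|j] ks kmin.
- have [y yc [yi _]] := sirr _ ks.
  have FG x : (x = lF i \/ x = rF i) -> c0 <= x <= c1 ->
      exists2 j, inr j \in s & lG j < x < rG j.
    move=> xi /scov[[i'|j] ks' /= xk]; last by exists j.
    have ii' : i <> i' by move=> e; move: xk; rewrite -e; case: xi => ->; lra.
    have [iF i'F] : 0 <= rF i - lF i /\ 0 <= rF i' - lF i' by move: yi xk => /=; lra.
    have len1 : 0 <= t * Num.min (rF i - lF i) (rF i' - lF i').
      by rewrite mulr_ge0 ?(ltW t0)// le_min iF.
    case: (sepF _ _ ii'); rewrite /apart ?[Num.min (rF i' - _) _]minC.
    - move=> nst; exfalso; apply: (notin _ _ ks ks' _ nst) => -[]; congruence.
    - move=> nst; exfalso; apply: (notin _ _ ks' ks _ nst) => -[]; congruence.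
    - by case: xi => e; rewrite e in xk; move: yi => /=; lra.
    - by case: xi => e; rewrite e in xk; move: yi => /=; lra.
  have lenG j : inr j \in s -> rF i - lF i <= t^-1 * (rG j - lG j).
    by move/kmin.
  have ltFi := ltF i; move: yi => /= yi.
  have [ac|ca] := ltP (lF i) c0; have [cb|bc] := ltP c1 (rF i).
  + by lra.
  + have [|j js jb] := FG (rF i) (or_intror erefl); first by lra.
    by have := lenG _ js; have := Gc0 j; lra.
  + have [|j js ja] := FG (lF i) (or_introl erefl); first by lra.
    by have := lenG _ js; have := Gc1 j; lra.
  have [|j js ja] := FG (lF i) (or_introl erefl); first by lra.
  have [|j' js' jb] := FG (rF i) (or_intror erefl); first by lra.
  have [e|/eqP jj'] := eqVneq j j'.
    apply: (notin _ _ ks js) => //=; rewrite -e in jb; lra.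
  have minw : rF i - lF i <= t^-1 * Num.min (rG j - lG j) (rG j' - lG j').
    by rewrite /Num.min; case: ifP => _; apply: lenG.
  case: (sepG _ _ jj'); rewrite /apart ?[Num.min (rG j' - _) _]minC; lra.
- have Gj := G0 j; have tj : 0 < t^-1 * (rG j - lG j).
    by rewrite mulr_gt0 ?subr_gt0.
  have GF x : (x = lG j \/ x = rG j) -> c0 <= x <= c1 ->
      exists2 i, inl i \in s & lF i < x < rF i.
    move=> xj /scov[[i|j'] ks' /= xk]; first by exists i.
    have jj' : j <> j' by move=> e; move: xk; rewrite -e; case: xj => ->; lra.
    by case: (GG _ _ jj'); case: xj xk => ->; have := G0 j'; lra.
  have Gcj0 := Gc0 j; have Gcj1 := Gc1 j.
  have [|i is_ ia] := GF (lG j) (or_introl erefl); first by lra.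
  have [|i' is' ib] := GF (rG j) (or_intror erefl); first by lra.
  have [e|/eqP ii'] := eqVneq i i'.
    by apply: (notin _ _ ks is_) => //=; rewrite -e in ib; lra.
  have minw : rG j - lG j <= t * Num.min (rF i - lF i) (rF i' - lF i').
    rewrite -ler_pdivrMl// /Num.min; case: ifP => _; exact: (kmin (inl _)).
  case: (sepF _ _ ii'); rewrite /apart ?[Num.min (rF i' - _) _]minC.
  + move=> nst; exfalso; apply: (notin _ _ is_ is' _ nst) => -[]; congruence.
  + move=> nst; exfalso; apply: (notin _ _ is' is_ _ nst) => -[]; congruence.
  + by lra.
  + by lra.
Qed.

End gap_lemma.

(** * Summable weights on strings *)

Section weights.
Local Open Scope ring_scope.
Local Open Scope classical_set_scope.
Variables (R : realType) (m : seq bool -> R).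
Hypotheses (m_ge0 : forall s, 0 <= m s)
  (m_sum : forall A : set (seq bool), (\esum_(s in A) (m s)%:E <= 1)%E).

Definition weight (A : set (seq bool)) : R := fine (\esum_(s in A) (m s)%:E).

Lemma weightE A : (weight A)%:E = (\esum_(s in A) (m s)%:E)%E.
Proof.
rewrite fineK// ge0_fin_numE; first by apply: le_lt_trans (m_sum A) (ltry _).
by apply: esum_ge0 => s _; rewrite lee_fin.
Qed.

Lemma weight_ge0 A : 0 <= weight A.
Proof.
by rewrite -lee_fin weightE; apply: esum_ge0 => s _; rewrite lee_fin.
Qed.

Lemma weightU A B : A `&` B = set0 -> weight (A `|` B) = weight A + weight B.
Proof.
move=> AB; apply: EFin_inj; rewrite EFinD !weightE.
rewrite (esumID A)//; last by move=> s _; rewrite lee_fin.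
congr (_ + _)%E; congr esum; first by rewrite setIUl setIid setIC [A `&` B]AB ?setU0.
by rewrite setIUl setICr set0U; apply/setIidPl; apply/disjoints_subset; rewrite setIC.
Qed.

Lemma weight_le A B : A `<=` B -> weight A <= weight B.
Proof.
move=> AB; rewrite -(setDUK AB) weightU ?lerDl ?weight_ge0//.
exact: setDIK.
Qed.

Lemma weightU_le A B : weight (A `|` B) <= weight A + weight B.
Proof.
rewrite (_ : A `|` B = A `|` (B `\` A)); last first.
  by apply/seteqP; split=> s /=; have [] := pselect (A s); tauto.
by rewrite weightU ?setDIK// lerD2l weight_le// => s [].
Qed.

Lemma weight_set1 s : weight [set s] = m s.
Proof. by apply: EFin_inj; rewrite weightE esum_set1// lee_fin. Qed.

Lemma weight_range_le (e : R) (f g : nat -> seq bool) : 0 <= e ->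
  injective f -> injective g -> (forall k, e * m (f k) <= m (g k)) ->
  e * weight (range f) <= weight (range g).
Proof.
move=> e0 finj ginj efg; rewrite -lee_fin EFinM !weightE.
rewrite (esum_image _ f); last by move=> ? ? _ _ /finj.
rewrite (esum_image _ g); last by move=> ? ? _ _ /ginj.
rewrite -!nneseries_esumT; do ?by move=> k; rewrite lee_fin.
rewrite -nneseriesZl//; last by move=> k _; rewrite lee_fin.
apply: lee_nneseries => k _; first by rewrite lee_fin mulr_ge0.
by rewrite -EFinM lee_fin.
Qed.

(** A finite set of strings carries all the weight up to e, and it contains
    only strings of bounded length. *)
Lemma weight_tail (e : R) : 0 < e ->
  exists n, weight [set s | (n <= size s)%N] < e.
Proof.
move=> e0.
have : ((weight setT - e)%:E < \esum_(s in setT) (m s)%:E)%E.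
  by rewrite -weightE lte_fin; lra.
move=> /ereal_sup_gt[_ [X [finX _] <-]].
have sX : (\sum_(s \in X) (m s)%:E)%E = (weight X)%:E.
  by rewrite weightE esum_fset// => s _; rewrite lee_fin.
rewrite sX lte_fin => eX.
have [n nX] : exists n, forall s, X s -> (size s < n)%N.
  exists (\max_(s <- finmap.enum_fset (fset_set X)) size s).+1 => s Xs.
  rewrite ltnS; apply: leq_bigmax_seq => //.
  by rewrite in_fset_set// mem_set.
exists n; have := @weight_le (X `|` [set s | (n <= size s)%N]) setT (@subsetT _ _).
rewrite weightU; first lra.
by rewrite -subset0 => s /= [/nX]; rewrite ltnNge => /negP.
Qed.

End weights.

(** * Strings to the left of a sequence *)

Section lexicographic.
Local Open Scope nat_scope.
Implicit Types (s u v : seq bool) (x : nat -> bool).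

(** This is [leL], by recursion on the string. The infinite sequence u b b b ...
    is written [nth b u]. *)
Fixpoint lexb s x : bool :=
  if s is b :: s' then
    if b == x 0 then lexb s' (fun i => x i.+1) else x 0
  else true.

Lemma restrS x n : restr x n.+1 = x 0 :: restr (fun i => x i.+1) n.
Proof. by rewrite /restr /mkseq /= -{1}[1]addn0 iotaDl -map_comp. Qed.

Lemma leLP s x : leL s x <-> lexb s x.
Proof.
elim: s x => [|b s IH] x /=; first by split=> [_|_]; [|right].
have [e|bx] := eqVneq b (x 0).
  rewrite -IH; split=> [[[[|n] [/= ns]]|]|[[n [ns sx bs xn]]|sx]].
  - by move=> _ /= bf xt; rewrite e xt in bf.
  - by rewrite restrS => /= -[_ sx] bs xn; left; exists n.
  - by rewrite /= restrS => -[_ ?]; right.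
  - by left; exists n.+1; split=> //=; rewrite restrS sx e.
  - by right; rewrite /= restrS -sx e.
split=> [[[[|n] [/= ns]]|]|x0].
- by move=> _ _.
- by rewrite restrS => /= -[bx']; rewrite bx' eqxx in bx.
- by rewrite /= restrS => -[bx']; rewrite bx' eqxx in bx.
- by left; exists 0; split=> //; case: b bx; rewrite x0.
Qed.

Lemma nth_nil_succ (b : bool) : (fun i => nth b [::] i.+1) = nth b [::].
Proof. by apply/funext => -[]. Qed.

Lemma lexb_true s : lexb s (nth true [::]).
Proof. by elim: s => [|[] s IH] //=; rewrite nth_nil_succ ?IH. Qed.

Lemma lexb_false s : lexb s (nth false [::]) = (s == nseq (size s) false).
Proof. by elim: s => [|[] s IH] //=; rewrite nth_nil_succ ?IH. Qed.

Lemma lexb_cons c s b u : lexb (c :: s) (nth b (c :: u)) = lexb s (nth b u).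
Proof. by rewrite /= eqxx. Qed.

Lemma lexb_cat u v b w : lexb (u ++ v) (nth b (u ++ w)) = lexb v (nth b w).
Proof. by elim: u => // c u IH; rewrite !cat_cons lexb_cons. Qed.

Definition agrees u x := forall i, i < size u -> x i = nth false u i.

Lemma lexb_low u x s : agrees u x -> lexb s (nth false u) -> lexb s x.
Proof.
elim: u x s => [|c u IH] x s ux.
  elim: s x {ux} => //= b s IHs x; case: b => //=.
  rewrite nth_nil_succ => sf; by case: (x 0) => //=; apply: IHs.
case: s => //= b s; rewrite (ux 0)//=; case: eqP => // _.
by apply: IH => i iu; apply: (ux i.+1).
Qed.

Lemma lexb_high u x s : agrees u x -> lexb s x -> lexb s (nth true u).
Proof.
elim: u x s => [|c u IH] x s ux; first by move=> _; apply: lexb_true.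
case: s => //= b s; rewrite (ux 0)//=; case: eqP => // _.
by apply: IH => i iu; apply: (ux i.+1).
Qed.

Lemma lexb_short u s : size s <= size u ->
  lexb s (nth true u) = lexb s (nth false u).
Proof.
by elim: u s => [|c u IH] [|b s] //= su; rewrite IH.
Qed.

(** Nothing lies strictly between u01111... and u10000..., so that only initial
    segments of the latter are new there. *)
Lemma lexb_gap u s : lexb s (nth false (rcons u true)) =
  lexb s (nth true (rcons u false)) ||
  (s == rcons u true ++ nseq (size s - (size u).+1) false).
Proof.
elim: u s => [|c u IH] [|b s] //=.
  by case: b => /=; rewrite ?lexb_true// lexb_false subn1 /= eqseq_cons.
by rewrite eqseq_cons IH subSS; case: (b == c) => //=; rewrite orbF.
Qed.

Lemma agrees_cat u v b : agrees u (nth b (u ++ v)).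
Proof. by move=> i iu; rewrite nth_cat iu; apply: set_nth_default. Qed.

Lemma nth_rcons_same (b : bool) u : nth b (rcons u b) = nth b u.
Proof.
apply/funext => i; rewrite nth_rcons; case: ltngtP => // iu.
  by rewrite nth_default// ltnW.
by rewrite nth_default// iu.
Qed.

Lemma string_trichotomy u v : u <> v ->
  [\/ exists b, prefix (rcons u b) v, exists b, prefix (rcons v b) u |
      exists w b, prefix (rcons w b) u /\ prefix (rcons w (~~ b)) v].
Proof.
elim: u v => [|a u IH] [|b v] //= uv.
- by constructor 1; exists b; rewrite eqxx prefix0s.
- by constructor 2; exists a; rewrite /= eqxx prefix0s.
have [e|ab] := eqVneq a b; last first.
  constructor 3; exists [::], a; rewrite /= eqxx !prefix0s.
  by case: a b ab {uv} => [] [].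
move: uv; rewrite {}e => uv; have [|[c cP]|[c cP]|[w [c [wu wv]]]] := IH v.
- by move=> uv'; rewrite uv' in uv.
- by constructor 1; exists c.
- by constructor 2; exists c.
- by constructor 3; exists (b :: w), c; rewrite /= eqxx.
Qed.

End lexicographic.

(** * The gaps of the left-cut function *)

Section cut_function.
Local Open Scope ring_scope.
Local Open Scope classical_set_scope.
Variables (R : realType) (m : seq bool -> R) (t : R).
Hypotheses (m_gt0 : forall s, 0 < m s)
  (m_sum : forall A : set (seq bool), (\esum_(s in A) (m s)%:E <= 1)%E)
  (t_gt0 : 0 < t)
  (m_rcons : forall s, t^-1 * m s <= m (rcons s true))
  (m_flip : forall s k, t^-1 * m (rcons s true ++ nseq k false) <=
    m (rcons (rcons s false ++ nseq k false) true)).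

Definition cut_sum (x : nat -> bool) : R := weight m [set s | leL s x].

Let m_ge0 s : 0 <= m s. Proof. exact: ltW. Qed.

Definition gapl u := cut_sum (nth true (rcons u false)).
Definition gapr u := cut_sum (nth false (rcons u true)).

Lemma cut_le x y : (forall s, lexb s x -> lexb s y) -> cut_sum x <= cut_sum y.
Proof.
move=> xy; apply: (weight_le m_ge0 m_sum) => s /= /leLP sx.
exact/leLP/xy.
Qed.

Lemma cut_low u x : agrees u x -> cut_sum (nth false u) <= cut_sum x.
Proof. by move=> ux; apply: cut_le => s; apply: lexb_low. Qed.

Lemma cut_high u x : agrees u x -> cut_sum x <= cut_sum (nth true u).
Proof. by move=> ux; apply: cut_le => s; apply: lexb_high. Qed.

Lemma cut_addr x y (g : nat -> seq bool) :
  (forall s, lexb s x -> lexb s y) ->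
  (forall k, lexb (g k) y && ~~ lexb (g k) x) ->
  cut_sum x + weight m (range g) <= cut_sum y.
Proof.
move=> xy gxy; rewrite -(weightU m_ge0 m_sum); last first.
  rewrite -subset0 => s [/leLP sx [k _ sg]].
  by have := gxy k; rewrite sg sx andbF.
apply: (weight_le m_ge0 m_sum) => s [/leLP/xy sy|[k _ <-]]; apply/leLP => //.
by have /andP[] := gxy k.
Qed.

Lemma gap_length u : gapr u - gapl u =
  weight m (range (fun k => rcons u true ++ nseq k false)).
Proof.
apply/eqP; rewrite subr_eq addrC -(weightU m_ge0 m_sum); last first.
  rewrite -subset0 => s [/leLP + [k _ sg]]; rewrite -sg.
  by rewrite cat_rcons -[rcons u false]cats1 lexb_cat.
apply/eqP; congr weight; apply/seteqP; split=> [s /leLP|s].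
  rewrite lexb_gap => /orP[?|/eqP ->]; first by left; apply/leLP.
  by right; exists (size s - (size u).+1)%N.
move=> [/leLP us|[k _ <-]]; apply/leLP; rewrite lexb_gap ?us//.
rewrite size_cat size_rcons size_nseq.
by rewrite addKn eqxx orbT.
Qed.

Lemma gap_gt0 u : gapl u < gapr u.
Proof.
rewrite -subr_gt0 gap_length; apply: lt_le_trans (m_gt0 (rcons u true)) _.
rewrite -(weight_set1 m_ge0 m_sum); apply: (weight_le m_ge0 m_sum) => s ->.
by exists 0%N => //=; rewrite cats0.
Qed.

Let zeros_inj u : injective (fun k => u ++ nseq k false).
Proof.
by move=> k k' /(congr1 size); rewrite !size_cat !size_nseq => /addnI.
Qed.

Lemma lexb_zeros_one k : lexb (rcons (nseq k false) true) (nth false [::]) = false.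
Proof. by rewrite lexb_false size_rcons size_nseq; elim: k. Qed.

(** The strings u10^k1, where u10^k ranges over the strings of the gap, are
    counted on the right of the gap. *)
Lemma gap_right_bridge u :
  gapr u + t^-1 * (gapr u - gapl u) <= cut_sum (nth true u).
Proof.
pose g k := rcons (rcons u true ++ nseq k false) true.
have gE k : g k = u ++ true :: rcons (nseq k false) true.
  by rewrite /g cat_rcons rcons_cat.
rewrite gap_length; apply: le_trans (_ : gapr u + weight m (range g) <= _).
  rewrite lerD2l; apply: (weight_range_le m_ge0 m_sum).
  - by rewrite invr_ge0 ltW.
  - exact: zeros_inj.
  - by move=> k k' /rcons_inj[] /zeros_inj.
  - by move=> k; apply: m_rcons.
apply: cut_addr => [s|k].
  by apply: lexb_high; rewrite -cats1; apply: agrees_cat.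
rewrite gE -[u in nth true u]cats0 -[rcons u true]cats1 !lexb_cat.
by rewrite lexb_cons lexb_zeros_one lexb_true.
Qed.

(** Here the strings u00^k1 do the same on the left of the gap. *)
Lemma gap_left_bridge u :
  cut_sum (nth false u) + t^-1 * (gapr u - gapl u) <= gapl u.
Proof.
pose g k := rcons (rcons u false ++ nseq k false) true.
have gE k : g k = u ++ false :: rcons (nseq k false) true.
  by rewrite /g cat_rcons rcons_cat.
rewrite gap_length; apply: le_trans (_ : cut_sum (nth false u) + weight m (range g) <= _).
  rewrite lerD2l; apply: (weight_range_le m_ge0 m_sum).
  - by rewrite invr_ge0 ltW.
  - exact: zeros_inj.
  - by move=> k k' /rcons_inj[] /zeros_inj.
  - by move=> k; apply: m_flip.
apply: cut_addr => [s|k].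
  by apply: lexb_low; rewrite -cats1; apply: agrees_cat.
rewrite gE -[u in nth false u]cats0 -[rcons u false]cats1 !lexb_cat.
by rewrite lexb_cons lexb_true /= nth_nil_succ lexb_zeros_one.
Qed.

Lemma cut_low_prefix u v : prefix u v -> cut_sum (nth false u) <= cut_sum (nth false v).
Proof. by move=> /prefixP[w ->]; apply/cut_low/agrees_cat. Qed.

Lemma cut_high_prefix u v : prefix u v -> cut_sum (nth true v) <= cut_sum (nth true u).
Proof. by move=> /prefixP[w ->]; apply/cut_high/agrees_cat. Qed.

(** Take the gap whose string extends the other string, or any of the two if the
    strings are incomparable. What f gains between this gap and the near end of
    the subtree of its string is gained between the two gaps. *)
Lemma gap_separated u v : u <> v ->
  apart gapl gapr t^-1 u v \/ apart gapl gapr t^-1 v u.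
Proof.
have ti : 0 < t^-1 by rewrite invr_gt0.
suff sep u1 u2 : (exists2 x, gapr u1 <= x & x + t^-1 * (gapr u2 - gapl u2) <= gapl u2) \/
    (exists2 x, gapr u1 + t^-1 * (gapr u1 - gapl u1) <= x & x <= gapl u2) ->
    apart gapl gapr t^-1 u1 u2.
  move=> /string_trichotomy[[b uv]|[b vu]|[w [b [wu wv]]]].
  - case: b uv => uv; [left|right]; apply: sep.
    + left; exists (cut_sum (nth false v)); first exact: cut_low_prefix.
      exact: gap_left_bridge.
    + right; exists (cut_sum (nth true v)); first exact: gap_right_bridge.
      exact: cut_high_prefix.
  - case: b vu => vu; [right|left]; apply: sep.
    + left; exists (cut_sum (nth false u)); first exact: cut_low_prefix.
      exact: gap_left_bridge.
    + right; exists (cut_sum (nth true u)); first exact: gap_right_bridge.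
      exact: cut_high_prefix.
  - case: b wu wv => wu wv; [right|left]; apply: sep; right.
    + exists (cut_sum (nth true v)); first exact: gap_right_bridge.
      apply: le_trans (cut_high_prefix wv) _; apply: le_trans (ltW (gap_gt0 w)) _.
      apply: le_trans (cut_low_prefix wu) _; have := gap_left_bridge u.
      by apply: le_trans; rewrite lerDl mulr_ge0 ?(ltW ti)// subr_ge0 ltW ?gap_gt0.
    + exists (cut_sum (nth true u)); first exact: gap_right_bridge.
      apply: le_trans (cut_high_prefix wu) _; apply: le_trans (ltW (gap_gt0 w)) _.
      apply: le_trans (cut_low_prefix wv) _; have := gap_left_bridge v.
      by apply: le_trans; rewrite lerDl mulr_ge0 ?(ltW ti)// subr_ge0 ltW ?gap_gt0.
rewrite /apart => H.
set mn := Num.min _ _; have m1 : t^-1 * mn <= t^-1 * (gapr u1 - gapl u1).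
  by rewrite ler_pM2l// ge_min lexx.
have m2 : t^-1 * mn <= t^-1 * (gapr u2 - gapl u2).
  by rewrite ler_pM2l// ge_min lexx orbT.
by case: H => -[x ? ?]; lra.
Qed.

Lemma cut_oscillation u :
  cut_sum (nth true u) <= cut_sum (nth false u) + weight m [set s | (size u <= size s)%N].
Proof.
apply: le_trans (weightU_le m_ge0 m_sum _ _); apply: (weight_le m_ge0 m_sum).
move=> s /= /leLP; have [us|su] := leqP (size u) (size s); first by right.
by rewrite lexb_short ?(ltnW su)// => sx; left; apply/leLP.
Qed.

(** Bisection: as y is in no gap, it lies below the left end or above the right
    end of the gap at the current string, which determines the next bit. *)
Lemma cut_surjective y : cut_sum (nth false [::]) <= y <= cut_sum (nth true [::]) ->
  (forall u, ~ (gapl u < y < gapr u)) -> exists x, cut_sum x = y.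
Proof.
move=> y01 ygap.
pose p := fix p n := if n is n'.+1 then rcons (p n') (gapl (p n') < y) else [::].
pose x n := gapl (p n) < y.
have pE n : restr x n = p n.
  elim: n => // n IH; rewrite -[in LHS]addn1 /restr mkseq_addn -/(restr x n) IH.
  by rewrite cats1 /= addn0.
have size_p n : size (p n) = n by elim: n => //= n IH; rewrite size_rcons IH.
have px n : agrees (p n) x.
  by move=> i; rewrite size_p => ni; rewrite -pE nth_mkseq.
have py n : cut_sum (nth false (p n)) <= y <= cut_sum (nth true (p n)).
  elim: n => //= n /andP[ny yn].
  case: (ltP (gapl (p n)) y) => [gy|yg].
    rewrite nth_rcons_same yn andbT leNgt; apply/negP => yg.
    by apply: (ygap (p n)); rewrite gy.
  by rewrite nth_rcons_same ny.
exists x; apply/eqP; rewrite -subr_eq0 -normr_le0; apply/ler_addgt0Pr => e e0.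
have [n ne] := weight_tail m_ge0 m_sum e0.
have := cut_oscillation (p n); rewrite size_p => osc.
have xl := cut_low (px n); have xh := cut_high (px n).
have := py n; rewrite add0r ler_norml; lra.
Qed.

End cut_function.

(** * Dyadic forbidden intervals *)

Section forbidden.
Local Open Scope ring_scope.
Variable R : realType.

(** The radius is twice the length 2^-(n(j+1)) of the block 1 0^(n-1), so that the
    open interval contains the closed interval of reals with this block, for
    both expansions of a dyadic real. *)
Definition forbl n (i : nat * int) : R :=
  2 ^- (n * i.1) * (i.2%:~R + 2^-1 - 2 * 2 ^- n).
Definition forbr n (i : nat * int) : R :=
  2 ^- (n * i.1) * (i.2%:~R + 2^-1 + 2 * 2 ^- n).

Lemma forb_length n i : forbr n i - forbl n i = 2 ^- (n * i.1) * (4 * 2 ^- n).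
Proof. by rewrite /forbr /forbl; lra. Qed.

(** Endpoints of a forbidden interval are integers at every finer scale, so a
    shorter forbidden interval, which is centred in an interval between two
    consecutive integers of its scale, cannot cross them. *)
Lemma forb_coarse n j e k : (0 < n)%N -> exists a b : int,
  forbl n (j, k) = 2 ^- (n * (j + e.+1)) * a%:~R /\
  forbr n (j, k) = 2 ^- (n * (j + e.+1)) * b%:~R.
Proof.
move=> n0; exists ((2 ^+ n * k + 2 ^+ n.-1 - 2) * 2 ^+ (n * e)),
  ((2 ^+ n * k + 2 ^+ n.-1 + 2) * 2 ^+ (n * e)).
rewrite /forbl /forbr /= mulnDr mulnS !exprD !invfM.
rewrite !(intrM, intrD, intrB) !rmorphXn /=.
have -> : 2 ^+ n = 2 * 2 ^+ n.-1 :> R by rewrite -exprS prednK.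
have x0 : 2 ^+ n.-1 != 0 :> R by rewrite expf_neq0.
have y0 : 2 ^+ (n * e) != 0 :> R by rewrite expf_neq0.
have z0 : 2 ^+ (n * j) != 0 :> R by rewrite expf_neq0.
by split; field; rewrite x0 y0 z0.
Qed.

Lemma forb_apart n (t : R) i i' : (0 < n)%N -> 0 < t -> 8 * t + 4 <= 2 ^+ n ->
  i <> i' ->
  [\/ nested (forbl n) (forbr n) i i', nested (forbl n) (forbr n) i' i,
      apart (forbl n) (forbr n) t i i' | apart (forbl n) (forbr n) t i' i].
Proof.
move=> n0 t0 tn; wlog : i i' / (i.1 <= i'.1)%N.
  move=> W ii'; have [le|/ltnW le] := leqP i.1 i'.1; first exact: W.
  by case: (W i' i le (fun e => ii' (esym e))) => ?;
    [constructor 2|constructor 1|constructor 4|constructor 3].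
have r4 : (2 + 4 * t) * 2 ^- n <= 2^-1 :> R.
  by rewrite ler_pdivrMr ?exprn_gt0//; lra.
have r0 : 0 < 2 ^- n :> R by rewrite invr_gt0 exprn_gt0.
have tr0 : 0 < t * 2 ^- n by rewrite mulr_gt0.
case: i i' => [j k] [j' k'] /= jj' ii'.
pose u : R := 2 ^- (n * j').
have u0 : 0 < u by rewrite invr_gt0 exprn_gt0.
have minE a b : t * Num.min (forbr n a - forbl n a) (forbr n b - forbl n b) <=
    t * (forbr n b - forbl n b).
  by rewrite ler_pM2l// ge_min lexx orbT.
have minE' a b : t * Num.min (forbr n a - forbl n a) (forbr n b - forbl n b) <=
    t * (forbr n a - forbl n a).
  by rewrite ler_pM2l// ge_min lexx.
have [e|lt] := eqVneq j j'.
  rewrite {}e in ii' *.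
  have same k1 k2 : k1 < k2 -> apart (forbl n) (forbr n) t (j', k1) (j', k2).
    rewrite /apart -lezD1 -(ler_int R) intrD => k12.
    pose i1 := (j', k1); pose d := forbr n i1 - forbl n i1.
    apply: le_trans (_ : _ <= forbr n i1 + t * d) _.
      by rewrite lerD2l.
    rewrite /d forb_length /forbr /forbl /= -/u mulrCA -mulrDr ler_pM2l//; lra.
  have [kk'|kk'|kk'] := ltgtP k k'; last by rewrite kk' in ii'.
  - by constructor 3; apply: same.
  - by constructor 4; apply: same.
have {jj' lt} [e je] : exists e, j' = (j + e.+1)%N.
  by exists (j' - j).-1; lia.
have [a [b [la rb]]] := @forb_coarse n j e k n0.
rewrite -je -/u in la rb.
have le_intR (x y : int) : x <= y -> x%:~R <= y%:~R :> R by rewrite ler_int.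
pose d := forbr n (j', k') - forbl n (j', k').
have [ak|ka] := lerP (k' + 1) a.
  constructor 4; rewrite /apart.
  apply: le_trans (_ : _ <= forbr n (j', k') + t * d) _.
    by rewrite lerD2l.
  have := le_intR _ _ ak; rewrite intrD => akR.
  rewrite la /d forb_length /forbr /= -/u mulrCA -mulrDr ler_pM2l//; lra.
have [bk|kb] := lerP b k'.
  constructor 3; rewrite /apart.
  apply: le_trans (_ : _ <= forbr n (j, k) + t * d) _.
    by rewrite lerD2l.
  have bkR := le_intR _ _ bk.
  rewrite rb /d forb_length /forbl /= -/u mulrCA -mulrDr ler_pM2l//; lra.
constructor 2; rewrite /nested la rb /forbl /forbr /= -/u !ler_pM2l//.
have akR : a%:~R <= k'%:~R :> R by rewrite ler_int -ltzD1.
have kbR : k'%:~R + 1 <= b%:~R :> R by rewrite -(intrD R k' 1) ler_int lezD1.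
by split; lra.
Qed.

End forbidden.

(** * Binary expansions *)

Section binary.
Local Open Scope ring_scope.
Local Open Scope classical_set_scope.
Variables (R : realType) (b : nat -> bool).

Let S n : R := \sum_(i < n) (b i)%:R * 2 ^- i.+1.

Lemma binary_prefix n : exists k : int, S n = 2 ^- n * k%:~R.
Proof.
elim: n => [|n [k IH]]; first by exists 0; rewrite /S big_ord0 mulr0.
exists (2 * k + (b n)%:R); rewrite /S big_ord_recr /= -/(S n) IH.
rewrite exprS invfM intrD intrM; case: (b n) => /=; lra.
Qed.

Lemma binary_tail n k : S n <= S (n + k) <= S n + 2 ^- n - 2 ^- (n + k).
Proof.
elim: k => [|k IH]; first by rewrite addn0; lra.
rewrite addnS /S big_ord_recr /= -!/(S _).
have : 0 < 2 ^- (n + k) :> R by rewrite invr_gt0 exprn_gt0.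
by move: IH; rewrite exprS invfM; case: (b _) => /=; lra.
Qed.

Lemma binary_bounds n y : binary_expansion b y -> S n <= y <= S n + 2 ^- n.
Proof.
move=> by_.
have near k : (n <= k)%N ->
    S n <= series (fun i => (b i)%:R * 2 ^- i.+1 : R) k <= S n + 2 ^- n.
  move=> nk; have := binary_tail n (k - n); rewrite subnKC//.
  have : 0 < 2 ^- k :> R by rewrite invr_gt0 exprn_gt0.
  by rewrite /series /= big_mkord -/(S k); lra.
apply/andP; split.
  apply: (cvgr_to_ge by_); exists n => // k /near /andP[]//.
apply: (cvgr_to_le by_); exists n => // k /near /andP[]//.
Qed.

Lemma binary_block n j y : (0 < n)%N -> binary_expansion b y ->
  mkseq (fun i => b (j * n + i)) n = true :: nseq n.-1 false ->
  exists k : int, forbl R n (j, k) < y < forbr R n (j, k).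
Proof.
move=> n0 by_ blk.
have bE i : (i < n)%N -> b (j * n + i) = (i == 0).
  move=> ni; have := congr1 (fun s => nth false s i) blk.
  rewrite nth_mkseq// => ->; case: i ni => //= i ni.
  by rewrite nth_nseq if_same.
have [k kE] := binary_prefix (j * n); exists k.
have SE i : (i < n)%N -> S (j * n + i.+1) = 2 ^- (j * n) * (k%:~R + 2^-1).
  elim: i => [|i IH] ni.
    rewrite addn1 /S big_ord_recr /= -/(S _) kE -[X in b X]addn0 bE//= exprS invfM.
    by lra.
  by rewrite addnS /S big_ord_recr /= -/(S _) IH ?(ltnW ni)// bE//= mul0r addr0.
have := binary_bounds (j * n + n.-1.+1) by_.
rewrite (SE n.-1) ?prednK// exprD invfM /forbl /forbr /= [(n * j)%N]mulnC.
have u0 : 0 < 2 ^- (j * n) :> R by rewrite invr_gt0 exprn_gt0.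
have r0 : 0 < 2 ^- n :> R by rewrite invr_gt0 exprn_gt0.
have := mulr_gt0 u0 r0; lra.
Qed.

End binary.

(** * A value that is not random *)

Section main.
Local Open Scope ring_scope.

Lemma exp2N_le (R : realType) k l c :
  oo_le k (oo_add l c) -> 2 ^- c * exp2N l <= exp2N k :> R.
Proof.
case: l k => [l|] [k|] //=; rewrite ?mulr0 ?invr_ge0 ?exprn_ge0// => kl.
rewrite -invfM -exprD addnC lef_pV2 ?posrE ?exprn_gt0//.
by rewrite ler_eXn2l ?ltr1n.
Qed.

Lemma exists_exp2_ge (R : realType) (x : R) : exists n, x <= 2 ^+ n.
Proof.
exists (Num.bound `|x|); apply: le_trans (ler_norm x) _.
apply/ltW/(lt_le_trans (archi_boundP (normr_ge0 _))).
by rewrite -natrX ler_nat; apply/ltnW/ltn_expl.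
Qed.

End main.

Local Open Scope ring_scope.

Theorem theorem5p11 (R : realType) (U : strpfun) (U_optimal : optimal U) :
  exists x : nat -> bool, ~ one_random U (Omega_fun U x : R).
Proof.
pose m s : R := exp2N (complexity U s).
have m_gt0 s : 0 < m s.
  have := complexity_finite s U_optimal; rewrite /m.
  by case: complexity => // n _; rewrite invr_gt0 exprn_gt0.
have m_sum A : (\esum_(s in A) (m s)%:E <= 1)%E.
  by apply: Omega_sum_le1; case: U_optimal => -[].
have [c1 c1E] := complexity_rcons U_optimal.
have [c2 c2E] := complexity_flip U_optimal.
pose t : R := 2 ^+ (c1 + c2).
have t0 : 0 < t by rewrite exprn_gt0.
have shrink c s s' : (c <= c1 + c2)%N ->
    oo_le (complexity U s') (oo_add (complexity U s) c) -> t^-1 * m s <= m s'.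
  move=> cc K; apply: le_trans (exp2N_le R K); rewrite -/(m s) ler_pM2r//.
  by rewrite lef_pV2 ?posrE ?exprn_gt0// ler_eXn2l ?ltr1n.
have m_rcons s := shrink _ _ _ (leq_addr _ _) (c1E s).
have m_flip s k := shrink _ _ _ (leq_addl _ _) (c2E s k).
pose a := cut_sum m (nth false [::]); pose z := cut_sum m (nth true [::]).
have gapl_ge u : a + t^-1 * (gapr m u - gapl m u) <= gapl m u.
  apply: le_trans _ (gap_left_bridge m_gt0 m_sum t0 m_flip u).
  by rewrite lerD2r; exact: (cut_low_prefix m_gt0 m_sum (prefix0s u)).
have gapr_le u : gapr m u + t^-1 * (gapr m u - gapl m u) <= z.
  apply: le_trans (gap_right_bridge m_gt0 m_sum t0 m_rcons u) _.
  exact: (cut_high_prefix m_gt0 m_sum (prefix0s u)).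
have az : a < z.
  have g0 := gap_gt0 m_gt0 m_sum [::]; have tg : 0 < t^-1 * (gapr m [::] - gapl m [::]).
    by rewrite mulr_gt0 ?invr_gt0 ?subr_gt0.
  by have := gapl_ge [::]; have := gapr_le [::]; lra.
(* With 8 * t + 4 <= 2 ^+ n the forbidden intervals have distances of at least
   t times their lengths; the last summand makes them shorter than z - a. *)
have [n nbig] := exists_exp2_ge (8 * t + 5 + 4 * (z - a)^-1).
have za : 0 < (z - a)^-1 by rewrite invr_gt0 subr_gt0.
have n0 : (0 < n)%N by case: n nbig => //; rewrite expr0; lra.
have n_len : 4 * 2 ^- n < z - a.
  rewrite ltr_pdivrMr ?exprn_gt0// -ltr_pdivrMl ?subr_gt0//; lra.
have [||||||y [yaz yF yG]] := @gap_lemma R _ _ (forbl R n) (forbr R n)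
    (gapl m) (gapr m) a z t t0 (ltW az).
- move=> i; rewrite forb_length; apply: le_lt_trans n_len.
  rewrite ler_piMl ?mulr_ge0 ?invr_ge0 ?exprn_ge0//.
  by rewrite invf_le1 ?exprn_gt0// exprn_ege1// ler1n.
- by move=> i i'; apply: forb_apart => //; lra.
- exact: gap_gt0.
- exact: gapl_ge.
- exact: gapr_le.
- exact: (gap_separated m_gt0 m_sum t0 m_rcons m_flip).
have [x xy] := cut_surjective m_gt0 m_sum yaz yG.
exists x => -[b]; rewrite (_ : Omega_fun U x = y)// => by_.
apply: (avoiding_not_random U_optimal n0 (w := true :: nseq n.-1 false)).
  by rewrite /= size_nseq prednK.
by move=> j /(binary_block n0 by_)[k]; apply: yF.
Qed.
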